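(* For all integers $m\ge 3$ and $l\ge -1$, the chromatic symmetric function $X_{D(m,l,3)}$ of the dumbbell graph $D(m,l,3)$ is $e$-positive.
   Context: All graphs are finite and simple; $C_n$ is the cycle and $P_l$ the path on the indicated number of vertices. For $m,n\ge 3$ and $l\ge 2$, the dumbbell graph $D(m,l,n)$ consists of disjoint $C_m$, $C_n$ and $P_l$, with one leaf of $P_l$ connected by an edge to one vertex of $C_m$ and the other leaf connected by an edge to one vertex of $C_n$. For $l=1$, the single vertex of $P_1$ is adjacent to one vertex of $C_m$ and to one vertex of $C_n$. For $l=0$, $D(m,0,n)$ is $C_m$ and $C_n$ (disjoint) connected by an edge. For $l=-1$, $D(m,-1,n)$ is $C_m$ and $C_n$ sharing exactly one vertex. The chromatic symmetric function of a graph $G$ with vertices $v_1,\ldots,v_d$ is $X_G=\sum_{\kappa} x_{\kappa(v_1)}\cdots x_{\kappa(v_d)}$, the sum over all proper colourings $\kappa:V(G)\to\mathbb{N}$, with $x_1,x_2,\ldots$ commuting variables. A symmetric function is $e$-positive if all its coefficients in the basis $\{e_\lambda\}$ of elementary symmetric functions ($e_\lambda=e_{\lambda_1}e_{\lambda_2}\cdots$) are nonnegative. *)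

(* Defs.v *)
From HB Require Import structures.
From mathcomp Require Import all_boot all_order all_algebra.
From mathcomp Require Import finmap.
From mathcomp.multinomials Require Import mpoly.

Set Implicit Arguments.
Unset Strict Implicit.
Unset Printing Implicit Defensive.

Import GRing.Theory.
Local Open Scope ring_scope.

Record sgraph := SGraph {
  vertex :> finType;
  adj : rel vertex;
  adj_sym : ssrbool.symmetric adj;
  adj_irr : irreflexive adj }.

(** ** Symmetric functions *)

(* A formal power series of bounded degree in countably many variables
   x_0, x_1, ... is determined by its restrictions to the variables
   x_0, ..., x_(N-1) (all other variables set to 0), so symmetric functions are
   represented by the sequence of these restrictions, as in the construction of
   the ring of symmetric functions as an inverse limit. *)
Definition symfun := forall N : nat, {mpoly rat[N]}.

Definition is_intpart (s : seq nat) := sorted geq s && (0%N \notin s).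

Record intpart := IntPart {
  parts :> seq nat;
  _ : is_intpart parts }.

HB.instance Definition _ := [isSub for parts].
HB.instance Definition _ := [Countable of intpart by <:].

(* [mesym N rat k] is the sum of all products of [k] distinct variables; it is
   0 when [N < k]. *)
Definition elemsym (la : intpart) : symfun :=
  fun N => \prod_(k <- la) mesym N rat k.

Definition e_expansion (F : symfun) (c : {fsfun intpart -> rat with 0}) :=
  forall N, F N = \sum_(la <- finsupp c) c la *: elemsym la N.

Definition intpart_mnm (N : nat) (la : intpart) : 'X_{1..N} :=
  [multinom count_mem i.+1 (parts la) | i < N].

Lemma elemsym_mPo (N : nat) (la : intpart) : all (geq N) la ->
  elemsym la N
  = 'X_[rat, intpart_mnm N la] \mPo [tuple mesym N rat i.+1 | i < N].
Proof.
case: la => s hs /= sN; rewrite comp_mpolyX /elemsym /=.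
have s0 : 0%N \notin s by case/andP: hs.
under [RHS]eq_bigr => i _ do rewrite tnth_mktuple mnmE /=.
elim: s {hs} s0 sN => [|k s IHs] /=.
  by rewrite big_nil big1 // => i _; rewrite expr0.
rewrite inE negb_or eq_sym => /andP[k0 s0] /andP[kN sN].
case: k k0 kN => // k _ kN.
rewrite big_cons IHs //; set f := (F in _ = \prod_i F i).
rewrite (bigD1 (Ordinal kN)) // [RHS](bigD1 (Ordinal kN)) //= mulrA.
rewrite /f /= eqxx exprS; congr (_ * _); apply: eq_bigr => i iN.
case: eqP => // -[ki]; case/eqP: iN; exact: val_inj.
Qed.

Lemma intpart_mnm_inj (N : nat) (la mu : intpart) :
  all (geq N) la -> all (geq N) mu ->
  intpart_mnm N la = intpart_mnm N mu -> la = mu.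
Proof.
case: la mu => [s hs] [t ht] /= sN tN E; apply: val_inj => /=.
case/andP: (hs) (ht) => ss s0 /andP[st t0].
apply: (@sorted_eq _ geq) => //.
- by move=> x y z /= h1 h2; apply: leq_trans h2 h1.
- by move=> x y /= h; apply/eqP; rewrite eqn_leq andbC.
apply/allP=> -[|k] _ /=; first by rewrite !(count_memPn _).
have [kN|kN] := ltnP k N.
  have := congr1 (fun m : 'X_{1..N} => m (Ordinal kN)) E.
  by rewrite !mnmE /= => ->.
rewrite !(count_memPn _) //; apply/negP.
- by move=> /(allP tN) /=; rewrite ltnNge kN.
- by move=> /(allP sN) /=; rewrite ltnNge kN.
Qed.

Lemma e_expansion_uniq (F : symfun) (c d : {fsfun intpart -> rat with 0}) :
  e_expansion F c -> e_expansion F d -> c = d.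
Proof.
move=> Fc Fd.
pose A := (finsupp c `|` finsupp d)%fset.
pose N := (\max_(la <- A) \max_(k <- parts la) k)%N.
have AN la : la \in A -> all (geq N) la.
  move=> laA; apply/allP=> k kla /=.
  by apply: (bigmaxn_sup_seq la) => //; apply: (bigmaxn_sup_seq k).
have expand (b : {fsfun intpart -> rat with 0}) :
  e_expansion F b -> (finsupp b `<=` A)%fset ->
  F N = (\sum_(la <- A) b la *: 'X_[rat, intpart_mnm N la])
          \mPo [tuple mesym N rat i.+1 | i < N].
  move=> -> bA; rewrite raddf_sum /= (big_fset_incl _ bA) /=; last first.
    by move=> la _ /fsfun_dflt ->; rewrite scale0r.
  rewrite big_seq [RHS]big_seq; apply: eq_bigr => la laA.
  by rewrite comp_mpolyZ elemsym_mPo ?AN.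
have := expand c Fc (fsubsetUl _ _).
rewrite (expand d Fd (fsubsetUr _ _)) => /msym_fundamental_un E.
apply/fsfunP => la; have [laA|] := boolP (la \in A); last first.
  by rewrite inE negb_or => /andP[/fsfun_dflt -> /fsfun_dflt ->].
have coef (b : intpart -> rat) :
  (\sum_(mu <- A) b mu *: 'X_[rat, intpart_mnm N mu])@_(intpart_mnm N la) = b la.
  rewrite raddf_sum /= (big_fsetD1 la) //= mcoeffZ mcoeffX eqxx mulr1.
  rewrite big_seq big1 ?addr0 // => mu; rewrite in_fsetD1 => /andP[mula muA].
  rewrite mcoeffZ mcoeffX; case: eqP => [/intpart_mnm_inj e|]; last by rewrite mulr0.
  by rewrite e ?eqxx ?AN in mula.
by rewrite -(coef c) -(coef d) E.
Qed.

(* By [e_expansion_uniq], [c] is the family of coefficients of [F] in the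
   basis of the [elemsym la]. *)
Definition e_positive (F : symfun) :=
  exists2 c, e_expansion F c & forall la, 0 <= c la.

Definition proper_colouring (G : sgraph) (C : finType) (kappa : {ffun G -> C}) :=
  [forall u, forall v, adj u v ==> (kappa u != kappa v)].

(* Setting x_i = 0 for all i >= N in the sum over proper colourings with
   arbitrary colours in nat leaves the colourings with colours below N. *)
Definition chromsym (G : sgraph) : symfun :=
  fun N => \sum_(kappa : {ffun G -> 'I_N} | proper_colouring kappa)
             \prod_(v : G) 'X_(kappa v).

(** ** Dumbbell graphs *)

(* Path a, a+1, ..., b. *)
Definition path_edge (a b i j : nat) := [&& (a <= i)%N, j == i.+1 & (j <= b)%N].

(* Cycle a, a+1, ..., b, a. *)
Definition cycle_edge (a b i j : nat) :=
  path_edge a b i j || (i == a) && (j == b).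

(* The cycle C_m is on the vertices 0, ..., m-1, the cycle C_n on the n vertices
   starting with m+l, and P_l on those in between.  The path m-1, ..., m+l
   consists of P_l and its connecting edges; it is a single edge if l = 0, and
   the single vertex m-1 common to both cycles if l = -1.  Each edge is listed
   here with its smaller end first. *)
Definition dumbbell_edge (m : nat) (l : int) (n i j : nat) :=
  let o := absz (m%:Z + l) in
  [|| cycle_edge 0 m.-1 i j, path_edge m.-1 o i j
    | cycle_edge o (o + n).-1 i j].

Definition dumbbell_adj (m : nat) (l : int) (n : nat) :
    rel 'I_(absz (m%:Z + l + n%:Z)) :=
  fun i j => (i != j) && (dumbbell_edge m l n i j || dumbbell_edge m l n j i).

Lemma dumbbell_sym m l n : ssrbool.symmetric (@dumbbell_adj m l n).
Proof. by move=> i j; rewrite /dumbbell_adj eq_sym orbC. Qed.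

Lemma dumbbell_irr m l n : irreflexive (@dumbbell_adj m l n).
Proof. by move=> i; rewrite /dumbbell_adj eqxx. Qed.

(* D(m,l,n), meaningful for m, n >= 3 and l >= -1. *)
Definition dumbbell (m : nat) (l : int) (n : nat) : sgraph :=
  SGraph (@dumbbell_sym m l n) (@dumbbell_irr m l n).

(* Main.v *)
Require Import Defs.
From mathcomp Require Import all_boot all_order all_algebra.
From mathcomp Require Import finmap.
From mathcomp.multinomials Require Import mpoly.
From mathcomp Require Import ring zify.

(** Write [P n], [C m] and [T m k] for the chromatic symmetric functions of the
    path on [n] vertices, of the cycle on [m] vertices and of the tadpole, a cycle
    on [m] vertices with a pendant path of [k] further vertices.

    Triple deletion at the triangle of [D(m, l, 3)], applied to the two edges at
    the vertex by which it is attached ([sum_triangle]), gives, with [k = l + 1],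
    [X = 2 (T m (k + 2) - e_2 T m k)] ([chromsym_dumbbell]).  It remains to show
    that the difference [tadpole_diff m k = T m (k + 2) - e_2 T m k] is
    e-positive.

    The paths satisfy the recurrence with nonnegative coefficients
    [P n = n e_n + sum_(1 <= j < n) (j - 1) e_j P (n - j)] ([path_poly_rec]), for
    which there is a bijective proof ([path_poly_mark]).  The modular relation
    [T (m + 1) k = T m (k + 1) - C m P (k + 1) + P (m + k + 1)], where
    [C m = T m 0], carries it over to tadpoles ([tadpole_rec]):
    [T m k = sum_(1 <= j < m) (j - 1) e_j T (m - j) k + (m - 1) S m k], where
    [S m k = P (m + k) - sum_(1 <= j < m) (j - 1) e_j P (m + k - j)] is the tail of
    the recurrence of the path on [m + k] vertices.  This is linear in [T] and [S],
    so that [tadpole_diff m k] obeys the same recurrence with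
    [S m (k + 2) - e_2 S m k] for [S m k], and induction on [m] reduces the claim to
    the e-positivity of this difference.  Compared term by term, it has nonnegative
    coefficients in products of an [e_j] with an [e_i], with some [P i], or with
    some [P (i + 2) - e_2 P i] where [i > 0] ([path_tail_diffE]); in the latter,
    [e_2 P i] cancels the term [j = 2] of the recurrence of [P (i + 2)]
    ([path_diffE]).

    All of these functions, in finitely many variables, are written with the
    transfer operator of proper colourings, for which the modular relation and
    triple deletion are identities between finite sums. *)

Set Implicit Arguments.
Unset Strict Implicit.
Unset Printing Implicit Defensive.
Import Order.TTheory GRing.Theory Num.Theory.
Local Open Scope ring_scope.

(** * The cone of e-positive symmetric functions *)

Section EPositive.
Implicit Types F G : symfun.

Lemma eq_e_positive F G : (forall N, F N = G N) -> e_positive F -> e_positive G.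
Proof. by move=> FG [c Fc c_ge0]; exists c => // N; rewrite -FG. Qed.

(** The sum may run over any finite set of partitions that contains the support
    of the coefficients. *)
Lemma e_expansionW F (c : {fsfun intpart -> rat with 0}) (A : {fset intpart}) :
  (finsupp c `<=` A)%fset ->
  (forall N, F N = \sum_(la <- A) c la *: elemsym la N) -> e_expansion F c.
Proof.
move=> cA FE N; rewrite FE [RHS](big_fset_incl _ cA) //= => la _ /fsfun_dflt ->.
by rewrite scale0r.
Qed.

Lemma e_positiveZ (q : rat) la : 0 <= q -> e_positive (fun N => q *: elemsym la N).
Proof.
move=> q_ge0; exists [fsfun mu in [fset la]%fset => q | 0]; last first.
  by move=> mu; rewrite fsfun_fun; case: ifP.
apply: (@e_expansionW _ _ [fset la]%fset); first exact: finsupp_sub.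
by move=> N; rewrite big_seq_fset1 fsfun_fun inE eqxx.
Qed.

Lemma e_positive0 : e_positive (fun N => 0).
Proof.
exists [fsfun]; last by move=> la; rewrite fsfun0E.
by move=> N; rewrite finsupp0 big_seq_fset0.
Qed.

Lemma e_positiveD F G :
  e_positive F -> e_positive G -> e_positive (fun N => F N + G N).
Proof.
move=> [c Fc c_ge0] [d Gd d_ge0].
pose A := (finsupp c `|` finsupp d)%fset.
have AE la : [fsfun mu in A => c mu + d mu | 0] la = c la + d la.
  rewrite fsfun_fun; case: ifPn => //; rewrite inE negb_or => /andP[cla dla].
  by rewrite !fsfun_dflt ?addr0.
exists [fsfun mu in A => c mu + d mu | 0].
  apply: (@e_expansionW _ _ A); first exact: finsupp_sub.
  move=> N; rewrite Fc Gd; under [RHS]eq_bigr do rewrite AE scalerDl.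
  rewrite big_split /=.
  rewrite (big_fset_incl _ (fsubsetUl (finsupp c) (finsupp d))) /=.
    rewrite [X in _ + X = _](big_fset_incl _ (fsubsetUr (finsupp c) _)) //=.
    by move=> la _ /fsfun_dflt ->; rewrite scale0r.
  by move=> la _ /fsfun_dflt ->; rewrite scale0r.
by move=> la; rewrite AE addr_ge0.
Qed.

Lemma e_positive_sum (J : eqType) (r : seq J) (F : J -> symfun) :
  {in r, forall j, e_positive (F j)} ->
  e_positive (fun N => \sum_(j <- r) F j N).
Proof.
elim: r => [|j r IHr] Fr.
  by apply: eq_e_positive e_positive0 => N; rewrite big_nil.
apply: eq_e_positive (e_positiveD (Fr j (mem_head _ _)) (IHr _)).
  by move=> N; rewrite big_cons.
by move=> i ir; apply: Fr; rewrite inE ir orbT.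
Qed.

Lemma e_positive_sum_nat m n (F : nat -> symfun) :
  (forall j, (m <= j < n)%N -> e_positive (F j)) ->
  e_positive (fun N => \sum_(m <= j < n) F j N).
Proof.
by move=> F_ge0; apply: e_positive_sum => j; rewrite mem_index_iota => /F_ge0.
Qed.

Lemma e_positiveMn F n : e_positive F -> e_positive (fun N => F N *+ n).
Proof.
move=> F_ge0; elim: n => [|n IHn].
  by apply: eq_e_positive e_positive0.
by apply: eq_e_positive (e_positiveD F_ge0 IHn) => N; rewrite mulrS.
Qed.

(** Adding a part to a partition; a part [0] only contributes the factor
    [mesym N rat 0 = 1]. *)
Lemma elemsym_cons k la :
  exists mu, forall N, elemsym mu N = mesym N rat k * elemsym la N.
Proof.
case: k => [|k]; first by exists la => N; rewrite mesym0E mul1r.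
case: la => s s_part; have /andP[_ s0] := s_part.
have ps : is_intpart (sort geq (k.+1 :: s)).
  rewrite /is_intpart mem_sort inE negb_or s0 !andbT.
  by apply: sort_sorted => a b; apply: leq_total.
exists (IntPart ps) => N; rewrite /elemsym /=.
by rewrite (perm_big (k.+1 :: s)) ?perm_sort // big_cons.
Qed.

Lemma e_positiveM k F : e_positive F -> e_positive (fun N => mesym N rat k * F N).
Proof.
move=> [c Fc c_ge0].
apply: (@eq_e_positive
  (fun N => \sum_(la <- finsupp c) c la *: (mesym N rat k * elemsym la N))).
  by move=> N; rewrite Fc mulr_sumr; apply: eq_bigr => la _; rewrite scalerAr.
apply: (@e_positive_sum _ _
  (fun la N => c la *: (mesym N rat k * elemsym la N))) => la _.
have [mu muE] := elemsym_cons k la.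
by apply: eq_e_positive (e_positiveZ mu (c_ge0 la)) => N; rewrite muE.
Qed.

Lemma e_positive_mesym k : e_positive (fun N => mesym N rat k).
Proof.
have ps : is_intpart [::] by [].
have := e_positiveM k (@e_positiveZ 1 (IntPart ps) ler01).
by apply: eq_e_positive => N; rewrite scale1r /elemsym /= big_nil mulr1.
Qed.
End EPositive.

(** * Weighted walks *)

Section Walks.
Variables (R : comNzRingType) (I : finType) (x : I -> R).
Implicit Types (f : I -> R) (a b : I) (i j k m n : nat).

(** The transfer operator of the complete graph on the colours, in which a step
    to the colour [b] costs [x b]: the [k]-th power of the operator sums over the
    proper colourings of a path of [k] further vertices hung onto a vertex of
    colour [a], and evaluates [f] at the colour of its end. *)
Definition transfer f a := \sum_(b | b != a) x b * f b.

Definition unit_at b a : R := (a == b)%:R.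

Definition walks k a := iter k transfer (fun=> 1) a.

Definition closed_walks m a := iter m transfer (unit_at a) a.

Definition path_poly n :=
  if n is k.+1 then \sum_a x a * walks k a else 1.

(** The closed walk lists the colours on the cycle and the free walk those on the
    pendant path.  For [m = 2] the cycle is a single edge, and for [m = 1] it is a
    loop, which admits no proper colouring ([tadpole1]). *)
Definition tadpole m k := \sum_a closed_walks m a * walks k a.

Lemma transferE f a : transfer f a = \sum_b x b * f b - x a * f a.
Proof. by rewrite [in RHS](bigD1 a) //= addrAC subrr add0r. Qed.

Lemma eq_transfer f g : f =1 g -> transfer f =1 transfer g.
Proof. by move=> fg a; apply: eq_bigr => b _; rewrite fg. Qed.

Lemma eq_iter_transfer k f g :
  f =1 g -> iter k transfer f =1 iter k transfer g.
Proof. by move=> fg; elim: k => //= k IHk; apply: eq_transfer. Qed.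

(** The powers of the transfer operator are linear, hence determined by their
    values on the unit vectors. *)
Lemma iter_transferE k f a :
  iter k transfer f a = \sum_b f b * iter k transfer (unit_at b) a.
Proof.
elim: k a => [|k IHk] a /=.
  rewrite (bigD1 a) //= /unit_at eqxx mulr1 big1 ?addr0 // => b ba.
  by rewrite eq_sym (negPf ba) mulr0.
under eq_transfer => c do rewrite IHk.
rewrite /transfer; under eq_bigr => c _ do rewrite mulr_sumr.
rewrite exchange_big; apply: eq_bigr => b _ /=.
by rewrite mulr_sumr; apply: eq_bigr => c _; rewrite mulrCA.
Qed.

Lemma iter_transferB k f g a :
  iter k transfer (fun b => f b - g b) a
  = iter k transfer f a - iter k transfer g a.
Proof.
rewrite iter_transferE [in RHS]iter_transferE (iter_transferE k g) -sumrB.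
by apply: eq_bigr => b _; rewrite mulrBl.
Qed.

Lemma iter_transferZ k c f a :
  iter k transfer (fun b => c * f b) a = c * iter k transfer f a.
Proof.
rewrite iter_transferE [in RHS]iter_transferE mulr_sumr.
by apply: eq_bigr => b _; rewrite mulrA.
Qed.

Lemma walksS k a : walks k.+1 a = path_poly k.+1 - x a * walks k a.
Proof. by rewrite /walks /= transferE. Qed.

(** The last step of a closed walk of positive length costs [x a] and starts
    anywhere but at [a], so what precedes it is a walk that is not closed. *)
Lemma closed_walksS m a :
  closed_walks m.+1 a = x a * (walks m a - closed_walks m a).
Proof.
rewrite /closed_walks iterSr /walks -iter_transferB -iter_transferZ.
apply: eq_iter_transfer => b; rewrite /unit_at /transfer.
have [->|ba] := eqVneq b a.
  rewrite subrr mulr0 big1 // => c ca.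
  by rewrite (negPf ca) mulr0.
rewrite subr0 (bigD1 a) 1?eq_sym //= eqxx big1 ?addr0 // => c /andP[_ ca].
by rewrite (negPf ca) mulr0.
Qed.

(** The vertex at which two paths meet may be slid along: the transfer operator
    is self-adjoint for the weight [x]. *)
Lemma path_poly_glue m k :
  \sum_a x a * walks m a * walks k a = path_poly (m + k).+1.
Proof.
elim: m k => [|m IHm] k.
  by apply: eq_bigr => a _; rewrite mulr1.
rewrite addSnnS -IHm.
transitivity (\sum_a \sum_(b | b != a) x a * x b * walks m b * walks k a).
  apply: eq_bigr => a _; rewrite /walks /= /transfer mulr_sumr mulr_suml.
  by apply: eq_bigr => b _; rewrite !mulrA.
rewrite (exchange_big_dep xpredT) //=; apply: eq_bigr => b _.
rewrite /walks /= /transfer mulr_sumr; apply: eq_big => [a|a _].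
  by rewrite eq_sym.
ring.
Qed.

Lemma tadpole1 k : tadpole 1 k = 0.
Proof.
apply: big1 => a _.
by rewrite closed_walksS /closed_walks /walks /= /unit_at eqxx subrr mulr0 mul0r.
Qed.

(** The modular relation at the edges that join the vertex of degree three to
    the path and to one of its neighbours on the cycle. *)
Lemma tadpole_modular m k :
  tadpole m.+1 k = tadpole m k.+1 - tadpole m 0 * path_poly k.+1
                   + path_poly (m + k).+1.
Proof.
rewrite -path_poly_glue /tadpole mulr_suml -sumrB -big_split /=.
by apply: eq_bigr => a _; rewrite closed_walksS transferE; ring.
Qed.

(** * Chromatic symmetric functions of paths *)

Definition elem_poly j := \sum_(h : {set I} | #|h| == j) \prod_(i in h) x i.

Definition elem_poly_avoid a j :=
  \sum_(h : {set I} | (a \notin h) && (#|h| == j)) \prod_(i in h) x i.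

Lemma elem_poly_mem a j :
  \sum_(h : {set I} | (a \in h) && (#|h| == j.+1)) \prod_(i in h) x i
  = x a * elem_poly_avoid a j.
Proof.
rewrite /elem_poly_avoid mulr_sumr.
rewrite (reindex_onto (fun h => a |: h) (fun h => h :\ a)) /=; last first.
  by move=> h /andP[ah _]; rewrite setD1K.
apply: eq_big => [h|h /andP[_ /eqP ah]].
  rewrite setU11 /= cardsU1.
  have [ah|ah] /= := boolP (a \in h).
    apply/negbTE/nandP; right; apply/eqP => /setP/(_ a).
    by rewrite !inE eqxx ah.
  by rewrite setU1K // eqxx andbT.
have {}ah : a \notin h by rewrite -ah !inE eqxx.
by rewrite big_setU1.
Qed.

Lemma elem_polyS a j :
  elem_poly j.+1 = elem_poly_avoid a j.+1 + x a * elem_poly_avoid a j.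
Proof.
rewrite -elem_poly_mem /elem_poly (bigID (fun h : {set I} => a \in h)) /=.
by rewrite addrC; congr (_ + _); apply: eq_bigl => h; rewrite andbC.
Qed.

Lemma elem_poly0_avoid a : elem_poly_avoid a 0 = elem_poly 0.
Proof.
apply: eq_bigl => h; rewrite cards_eq0.
by case: eqP => [->|]; rewrite ?inE ?andbF.
Qed.

Lemma elem_poly0 : elem_poly 0 = 1.
Proof.
rewrite /elem_poly (big_pred1 set0) ?big_set0 // => h.
by rewrite cards_eq0.
Qed.

(** Both sides count the sets of [j.+1] colours with one of them marked. *)
Lemma elem_poly_mark j :
  elem_poly j.+1 *+ j.+1 = \sum_a x a * elem_poly_avoid a j.
Proof.
under eq_bigr => a _ do rewrite -elem_poly_mem.
rewrite (exchange_big_dep (fun h : {set I} => #|h| == j.+1)) /=; last first.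
  by move=> a h _ /andP[].
rewrite -sumrMnl; apply: eq_bigr => h /eqP hj.
under [RHS]eq_bigl => a do rewrite hj eqxx andbT.
by rewrite sumr_const hj.
Qed.

(** The part of [path_poly n] in which the first vertex has colour [a]; it is [0]
    for the empty path, which has no first vertex. *)
Definition path_poly_at a n := if n is k.+1 then x a * walks k a else 0.

(** A vertex of colour [a] can be put in front of a path, unless the path itself
    starts with [a]. *)
Lemma path_poly_atS a n :
  x a * path_poly n = path_poly_at a n.+1 + x a * path_poly_at a n.
Proof.
case: n => [|n]; first by rewrite /= mulr0 addr0.
rewrite /path_poly_at walksS; ring.
Qed.

(** Both sides count pairs of a set [h] of colours and a properly coloured path.
    On the left a colour [a] of [h] is marked.  If the path starts with [a],
    forget the mark; otherwise move [a] from [h] to the front of the path.  Since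
    the first colour of the resulting path is [a], and belongs to [h] in the first
    case only, this is a bijection onto the pairs with a nonempty path. *)
Lemma path_poly_mark n :
  \sum_(j < n) elem_poly j.+1 *+ j.+1 * path_poly (n - j.+1)
  = \sum_(j < n) elem_poly j * path_poly (n - j).
Proof.
transitivity (\sum_a \sum_(j < n) elem_poly_avoid a j
                * (path_poly_at a (n - j) + x a * path_poly_at a (n - j.+1))).
  rewrite exchange_big; apply: eq_bigr => j _.
  rewrite elem_poly_mark mulr_suml; apply: eq_bigr => a _.
  by rewrite mulrAC [LHS]mulrC path_poly_atS subnSK.
transitivity (\sum_a \sum_(j < n) elem_poly j * path_poly_at a (n - j)).
  apply: eq_bigr => a _; case: n => [|n]; first by rewrite !big_ord0.
  under eq_bigr => j _ do rewrite mulrDr.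
  rewrite big_split /= big_ord_recl [X in _ + X = _]big_ord_recr /=.
  rewrite subnn /= !mulr0 addr0 [RHS]big_ord_recl elem_poly0_avoid /= -addrA.
  rewrite -big_split /=; congr (_ + _); apply: eq_bigr => j _.
  rewrite /bump /= !add1n (elem_polyS a) mulrDl mulrA subSS.
  by rewrite [x a * _]mulrC.
rewrite exchange_big; apply: eq_bigr => j _; rewrite -mulr_sumr.
by have := ltn_ord j; rewrite -subn_gt0; case: (n - j)%N.
Qed.

(** This is [path_poly_mark] without the pairs [(j, n - j)] that occur on both of
    its sides; subtracting them lowers the multiplicity [j] to [j - 1]. *)
Lemma path_poly_rec n :
  path_poly n.+1
  = elem_poly n.+1 *+ n.+1
    + \sum_(1 <= j < n.+1) elem_poly j * path_poly (n.+1 - j) *+ j.-1.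
Proof.
have := path_poly_mark n.+1; rewrite big_ord_recr [in RHS]big_ord_recl.
rewrite subnn elem_poly0 mul1r mulr1 -/path_poly => pathE.
rewrite big_add1 big_mkord.
apply: (addIr
  (\sum_(j < n) elem_poly (lift ord0 j) * path_poly (n.+1 - lift ord0 j))).
rewrite [LHS]/= subn0 in pathE.
rewrite -[LHS]pathE addrC -addrA -big_split; congr (_ + _).
by apply: eq_bigr => j _; rewrite /= /bump /= add1n -mulrSr mulrnAl.
Qed.

(** * Recurrences for tadpoles *)

(** The terms of the recurrence of [path_poly (m + k)] from [j = m] on
    ([path_tailE]).  It is defined as the complement of the terms [j < m] because
    that is the form in which it arises from the modular relation. *)
Definition path_tail m k :=
  path_poly (m + k)
  - \sum_(1 <= j < m) elem_poly j * path_poly (m + k - j) *+ j.-1.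

Lemma path_tailE m k : (0 < m)%N ->
  path_tail m k
  = elem_poly (m + k) *+ (m + k)
    + \sum_(m <= j < m + k) elem_poly j * path_poly (m + k - j) *+ j.-1.
Proof.
case: m => // m _; rewrite /path_tail addSn path_poly_rec.
rewrite (@big_cat_nat _ _ _ m.+1) ?ltnS ?leq_addr //= addrA addrAC.
by rewrite addrK.
Qed.

Lemma path_tailS m k :
  path_tail m.+2 k = path_tail m.+1 k.+1 - elem_poly m.+1 * path_poly k.+1 *+ m.
Proof.
rewrite /path_tail addSnnS big_nat_recr // opprD addrA.
by rewrite addKn.
Qed.

(** The recurrence of paths passes to tadpoles along the modular relation, by
    induction on the length of the cycle.  The relation lengthens the cycle at the
    expense of the path, so the induction hypothesis is needed at [k.+1], and at
    [0] for the cycle that splits off. *)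
Lemma tadpole_rec m k :
  tadpole m.+1 k
  = \sum_(1 <= j < m.+1) elem_poly j * tadpole (m.+1 - j) k *+ j.-1
    + path_tail m.+1 k *+ m.
Proof.
elim: m k => [|m IHm] k; first by rewrite tadpole1 big_geq // addr0.
have tailE : path_poly (m.+1 + k).+1 = path_tail m.+1 k.+1
    + \sum_(1 <= j < m.+1) elem_poly j * path_poly (m.+1 + k.+1 - j) *+ j.-1.
  by rewrite /path_tail addnS subrK.
have tail0 : path_tail m.+1 0 = elem_poly m.+1 *+ m.+1.
  by rewrite path_tailE // addn0 big_geq // addr0.
have sumE : \sum_(1 <= j < m.+2) elem_poly j * tadpole (m.+2 - j) k *+ j.-1
  = \sum_(1 <= j < m.+1) elem_poly j * tadpole (m.+1 - j) k.+1 *+ j.-1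
    - (\sum_(1 <= j < m.+1) elem_poly j * tadpole (m.+1 - j) 0 *+ j.-1)
        * path_poly k.+1
    + \sum_(1 <= j < m.+1) elem_poly j * path_poly (m.+1 + k.+1 - j) *+ j.-1.
  rewrite big_nat_recr //= subSnn tadpole1 mulr0 mul0rn addr0.
  rewrite mulr_suml -sumrB -big_split /=; apply: eq_big_nat => j /andP[_ jm].
  rewrite subSn 1?ltnW // tadpole_modular -addnBAC 1?ltnW // addnS.
  by rewrite mulrDr mulrBr mulrnDl mulrnBl mulrA mulrnAl.
rewrite tadpole_modular !IHm sumE tailE tail0 path_tailS.
ring.
Qed.

(** For [m >= 3], half of the chromatic symmetric function of
    [D(m, k - 1, 3)]. *)
Definition tadpole_diff m k := tadpole m k.+2 - elem_poly 2 * tadpole m k.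

Lemma tadpole_diff_rec m k :
  tadpole_diff m.+1 k
  = \sum_(1 <= j < m.+1) elem_poly j * tadpole_diff (m.+1 - j) k *+ j.-1
    + (path_tail m.+1 k.+2 - elem_poly 2 * path_tail m.+1 k) *+ m.
Proof.
rewrite /tadpole_diff !tadpole_rec mulrDr opprD addrACA mulr_sumr -sumrB.
congr (_ + _); last by rewrite [RHS]mulrnBl mulrnAr.
by apply: eq_bigr => j _; rewrite mulrBr [RHS]mulrnBl mulrnAr mulrCA.
Qed.

Lemma path_poly2 : path_poly 2 = elem_poly 2 *+ 2.
Proof. by rewrite path_poly_rec big_nat1 mulr0n addr0. Qed.

(** Multiplying by [e_2] and adding two vertices is the term [j = 2] of the
    recurrence, whose coefficient is [1]. *)
Lemma path_diffE n :
  path_poly n.+3 - elem_poly 2 * path_poly n.+1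
  = elem_poly n.+3 *+ n.+3
    + \sum_(3 <= j < n.+3) elem_poly j * path_poly (n.+3 - j) *+ j.-1.
Proof.
rewrite path_poly_rec big_ltn // mulr0n add0r big_ltn // mulr1n.
by rewrite (_ : n.+3 - 2 = n.+1)%N // addrAC addrA subrK.
Qed.

(** The terms [j < m + k + 2] of the two tails match.  The only negative term left
    is [- (m + k + 2) e_2 e_(m + k + 2)]; it is absorbed by the term
    [j = m + k + 2] of the longer tail, [(m + k + 1) e_(m + k + 2) P 2], since
    [P 2 = 2 e_2].  A coefficient [m + k] remains, so that a cycle of length at
    least [2] is needed here. *)
Lemma path_tail_diffE m k :
  path_tail m.+2 k.+2 - elem_poly 2 * path_tail m.+2 k
  = elem_poly (m + k).+4 *+ (m + k).+4
    + elem_poly (m + k).+3 * path_poly 1 *+ (m + k).+2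
    + elem_poly (m + k).+2 * elem_poly 2 *+ (m + k)
    + \sum_(m.+2 <= j < (m + k).+2)
        elem_poly j * (path_poly ((m + k).+2 - j).+2
                       - elem_poly 2 * path_poly ((m + k).+2 - j)) *+ j.-1.
Proof.
set p1 := path_poly 1.
rewrite !path_tailE // !addSn !addnS big_nat_recr ?ltnS ?leqW ?leq_addr //=.
rewrite big_nat_recr ?ltnS ?leq_addr //= subSnn -/p1.
rewrite -[in X in path_poly X](addn2 (m + k).+2) addKn path_poly2.
have -> : \sum_(m.+2 <= j < (m + k).+2)
      elem_poly j * (path_poly ((m + k).+2 - j).+2
                     - elem_poly 2 * path_poly ((m + k).+2 - j)) *+ j.-1
  = \sum_(m.+2 <= j < (m + k).+2)
      elem_poly j * path_poly ((m + k).+4 - j) *+ j.-1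
    - elem_poly 2 * \sum_(m.+2 <= j < (m + k).+2)
      elem_poly j * path_poly ((m + k).+2 - j) *+ j.-1.
  rewrite mulr_sumr -sumrB; apply: eq_big_nat => j /andP[_ /ltnW jmk].
  rewrite (subSn (leqW jmk)) (subSn jmk) mulrBr [LHS]mulrnBl mulrnAr.
  by rewrite [elem_poly 2 * (_ * _)]mulrCA.
ring.
Qed.

End Walks.

(** * Positivity of tadpole differences *)

(** At these weights [elem_poly] and [mesym] are convertible, so the identities
    for [elem_poly] are used below as identities for [mesym]. *)
Definition vars N (i : 'I_N) : {mpoly rat[N]} := 'X_i.

Lemma path_poly_e_positive n : e_positive (fun N => path_poly (@vars N) n).
Proof.
elim/ltn_ind: n => -[|n] IHn.
  by apply: eq_e_positive (e_positive_mesym 0) => N; rewrite mesym0E.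
apply: eq_e_positive => [N|]; first by rewrite path_poly_rec.
apply: e_positiveD; first exact/e_positiveMn/e_positive_mesym.
apply: e_positive_sum_nat => j /andP[j_gt0 _].
by apply/e_positiveMn/e_positiveM/IHn; rewrite ltn_subrL j_gt0.
Qed.

Lemma path_diff_e_positive n :
  e_positive (fun N => path_poly (@vars N) n.+3
                       - mesym N rat 2 * path_poly (@vars N) n.+1).
Proof.
apply: eq_e_positive => [N|]; first by rewrite (path_diffE (@vars N)).
apply: e_positiveD; first exact/e_positiveMn/e_positive_mesym.
apply: e_positive_sum_nat => j _.
exact/e_positiveMn/e_positiveM/path_poly_e_positive.
Qed.

Lemma path_tail_diff_e_positive m k :
  e_positive (fun N => path_tail (@vars N) m.+2 k.+2
                       - mesym N rat 2 * path_tail (@vars N) m.+2 k).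
Proof.
apply: eq_e_positive => [N|]; first by rewrite (path_tail_diffE (@vars N)).
apply: e_positiveD; [apply: e_positiveD; [apply: e_positiveD|]|].
- exact/e_positiveMn/e_positive_mesym.
- exact/e_positiveMn/e_positiveM/path_poly_e_positive.
- exact/e_positiveMn/e_positiveM/e_positive_mesym.
apply: e_positive_sum_nat => j /andP[_ jmk].
apply/e_positiveMn/e_positiveM.
rewrite -subn_gt0 in jmk; case: (_ - j)%N jmk => // i _.
exact: path_diff_e_positive.
Qed.

Lemma tadpole_diff_e_positive m k :
  e_positive (fun N => tadpole_diff (@vars N) m.+1 k).
Proof.
elim/ltn_ind: m => m IHm.
apply: eq_e_positive => [N|]; first by rewrite tadpole_diff_rec.
apply: e_positiveD.
  apply: e_positive_sum_nat => j /andP[j_gt0 jm]; apply/e_positiveMn/e_positiveM.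
  rewrite ltnS in jm; rewrite subSn //; apply: IHm.
  by rewrite ltn_subrL j_gt0 (leq_trans j_gt0 jm).
(* For a cycle of length [1] the coefficient of the tails is [0]. *)
case: m {IHm} => [|m]; first exact: eq_e_positive e_positive0.
exact/e_positiveMn/path_tail_diff_e_positive.
Qed.

(** * Colourings of dumbbells as words *)

Section Words.
Variables (R : comNzRingType) (I : finType) (x : I -> R).
Implicit Types (f : I -> R) (a b c : I) (k m n : nat) (s t : seq I).

Lemma sum_tuple_cons n (C : pred (seq I)) (F : seq I -> R) :
  \sum_(t : n.+1.-tuple I | C t) F t
  = \sum_a \sum_(t : n.-tuple I | C (a :: t)) F (a :: t).
Proof.
rewrite pair_big_dep /=.
rewrite (reindex (fun p : I * n.-tuple I => [tuple of p.1 :: p.2])) //=.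
exists (fun t : n.+1.-tuple I => (thead t, [tuple of behead t])) => [[a t] _|t _] /=.
  by rewrite theadE; congr (_, _); apply: val_inj.
by rewrite [RHS]tuple_eta.
Qed.

Lemma sum_tuple0 (C : pred (seq I)) (F : seq I -> R) :
  \sum_(t : 0.-tuple I | C t) F t = if C [::] then F [::] else 0.
Proof.
rewrite big_mkcond (big_pred1 [tuple]) // => t.
by rewrite [t]tuple0; apply/esym/eqP.
Qed.

Lemma sum_tuple_cat m n (C : pred (seq I)) (F : seq I -> R) :
  \sum_(t : (m + n).-tuple I | C t) F t
  = \sum_(s : m.-tuple I) \sum_(t : n.-tuple I | C (s ++ t)) F (s ++ t).
Proof.
elim: m C F => [|m IHm] C F.
  by rewrite (sum_tuple0 predT
    (fun s => \sum_(t : n.-tuple I | C (s ++ t)) F (s ++ t))).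
rewrite (sum_tuple_cons m predT
  (fun s => \sum_(t : n.-tuple I | C (s ++ t)) F (s ++ t))).
rewrite addSn sum_tuple_cons; apply: eq_bigr => a _.
exact: (IHm (fun t => C (a :: t)) (fun t => F (a :: t))).
Qed.

Definition proper_word a s := path (fun b c => c != b) a s.

Lemma sum_proper_words k f a :
  \sum_(t : k.-tuple I | proper_word a t) \prod_(b <- t) x b * f (last a t)
  = iter k (transfer x) f a.
Proof.
elim: k a => [|k IHk] a.
  rewrite (sum_tuple0 (proper_word a)
             (fun t => \prod_(b <- t) x b * f (last a t))).
  by rewrite big_nil mul1r.
rewrite (sum_tuple_cons k (proper_word a)
           (fun t => \prod_(b <- t) x b * f (last a t))) /= /transfer.
rewrite [RHS]big_mkcond; apply: eq_bigr => b _ /=; case: ifP => _.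
  rewrite -IHk mulr_sumr; apply: eq_bigr => t _.
  by rewrite big_cons mulrA.
by rewrite big_pred0.
Qed.

(** The proper colourings of [D(m + 1, k - 1, 3)], read off along its vertices:
    consecutive vertices are adjacent, and one further edge closes each cycle. *)
Definition dumbbell_word m k t :=
  if t is a :: s then
    [&& proper_word a s, nth a t m != a & nth a t (m + k).+2 != nth a t (m + k)]
  else true.

Lemma dumbbell_word_cat m k a s1 s2 t :
  size s1 = m -> size s2 = k -> size t = 2 ->
  dumbbell_word m k (a :: s1 ++ s2 ++ t)
  = let b := last a s1 in let c := last b s2 in
    [&& proper_word a s1, b != a, proper_word b s2, proper_word c t
      & last c t != c].
Proof.
move=> <- <-; case: t => [|d [|e []]] // _.
have nth_m : nth a (a :: s1 ++ s2 ++ [:: d; e]) (size s1) = last a s1.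
  by rewrite -cat_cons nth_cat /= ltnSn -last_nth.
have nth_mk i : nth a (a :: s1 ++ s2 ++ [:: d; e]) (size s1 + size s2 + i)
    = nth a [:: last (last a s1) s2; d; e] i.
  rewrite -size_cat catA -cat_cons nth_cat /= ltnS.
  case: i => [|i]; first by rewrite addn0 leqnn -last_nth last_cat.
  by rewrite addnS ltnNge leq_addr /= subSS addKn.
rewrite /dumbbell_word nth_m -addn2 nth_mk -[X in nth _ _ X == _]addn0.
rewrite -[X in _ != nth _ _ X]addn0 nth_mk /= /proper_word !cat_path /= -!andbA.
by do ?bool_congr.
Qed.

Lemma sum_dumbbell_words m k :
  \sum_(t : (m + (k + 2)).+1.-tuple I | dumbbell_word m k t) \prod_(b <- t) x b
  = \sum_a x a * iter m (transfer x) (fun b => (b != a)%:R *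
      iter k (transfer x) (fun c =>
        iter 2 (transfer x) (fun d => (d != c)%:R) c) b) a.
Proof.
rewrite (sum_tuple_cons _ (dumbbell_word m k) (fun t => \prod_(b <- t) x b)).
apply: eq_bigr => a _.
rewrite (sum_tuple_cat m (k + 2) (fun t => dumbbell_word m k (a :: t))
          (fun t => \prod_(b <- a :: t) x b)).
rewrite -sum_proper_words mulr_sumr [RHS]big_mkcond; apply: eq_bigr => s1 _.
rewrite (sum_tuple_cat k 2 (fun t => dumbbell_word m k (a :: s1 ++ t))
          (fun t => \prod_(b <- a :: s1 ++ t) x b)).
have [as1|/negbTE as1] := boolP (proper_word a s1); last first.
  rewrite big1 // => s2 _; rewrite big_pred0 // => t.
  by rewrite dumbbell_word_cat ?size_tuple //= as1.
rewrite -sum_proper_words !mulr_sumr [RHS]big_mkcond.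
apply: eq_bigr => s2 _.
have [s12|/negbTE s12] := boolP (proper_word (last a s1) s2); last first.
  rewrite big_pred0 ?mulr0 // => t.
  by rewrite dumbbell_word_cat ?size_tuple //= as1 s12 andbF.
rewrite -(sum_proper_words 2) !mulr_sumr [RHS]big_mkcond [LHS]big_mkcond.
apply: eq_bigr => t _.
rewrite dumbbell_word_cat ?size_tuple //= as1 s12 /=.
case: (proper_word _ t); last by rewrite andbF.
case: (last a s1 != a); last by rewrite !(mul0r, mulr0).
case: (last _ t != _); last by rewrite !mulr0.
rewrite big_cons !big_cat /=; ring.
Qed.

(** A cycle coloured from [a] around to a neighbour [b] of its first vertex, where
    the rest of the graph is attached, is a closed walk based at [b]. *)
Lemma sum_closed_transfer m f :
  \sum_a x a * iter m (transfer x) (fun b => (b != a)%:R * f b) a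
  = \sum_a closed_walks x m.+1 a * f a.
Proof.
under eq_bigr => a _ do rewrite iter_transferE mulr_sumr.
rewrite exchange_big; apply: eq_bigr => b _ /=.
rewrite /closed_walks /= /transfer mulr_suml [RHS]big_mkcond.
apply: eq_bigr => a _; rewrite eq_sym; case: (a != b) => /=; last first.
  by rewrite !mul0r mulr0.
by rewrite mul1r mulrA mulrAC.
Qed.

(** The triangle hung onto a vertex of colour [c]: of the two vertices of an edge
    at most one has colour [c], so that the colourings avoiding [c] on both are
    those avoiding it on the first, plus those avoiding it on the second, minus all
    of them.  This is triple deletion. *)
Lemma sum_triangle c :
  iter 2 (transfer x) (fun d => (d != c)%:R) c
  = 2%:R * walks x 2 c - 2%:R * elem_poly x 2.
Proof.
have -> : iter 2 (transfer x) (fun d => (d != c)%:R) c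
          = walks x 2 c - closed_walks x 2 c.
  rewrite /walks /closed_walks -iter_transferB; apply: eq_iter_transfer => d.
  by rewrite /unit_at; case: eqP; rewrite ?subr0 ?subrr.
have closed1 : closed_walks x 1 c = 0.
  by rewrite closed_walksS /closed_walks /walks /= /unit_at eqxx subrr mulr0.
rewrite closed_walksS closed1 walksS path_poly2; ring.
Qed.

Lemma sum_dumbbell_wordsE m k :
  \sum_(t : (m + (k + 2)).+1.-tuple I | dumbbell_word m k t) \prod_(b <- t) x b
  = tadpole_diff x m.+1 k *+ 2.
Proof.
rewrite sum_dumbbell_words (sum_closed_transfer m (fun b => iter k (transfer x)
  (fun c => iter 2 (transfer x) (fun d => (d != c)%:R) c) b)).
rewrite /tadpole_diff /tadpole mulr_sumr -sumrB -sumrMnl.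
apply: eq_bigr => b _.
have -> : iter k (transfer x)
    (fun c => iter 2 (transfer x) (fun d => (d != c)%:R) c) b
    = 2%:R * walks x k.+2 b - 2%:R * elem_poly x 2 * walks x k b.
  rewrite -[k.+2]addn2 /walks iterD -!iter_transferZ -iter_transferB.
  by apply: eq_iter_transfer => c; rewrite sum_triangle mulr1.
ring.
Qed.

Lemma sum_ffun_tuple n (C : pred {ffun 'I_n -> I}) (F : {ffun 'I_n -> I} -> R) :
  \sum_(kappa | C kappa) F kappa
  = \sum_(t : n.-tuple I | C [ffun i => tnth t i]) F [ffun i => tnth t i].
Proof.
rewrite (reindex (fun t : n.-tuple I => [ffun i => tnth t i])) //.
exists (fun f : {ffun 'I_n -> I} => [tuple f i | i < n]) => [t|f] _.
  by apply: eq_from_tnth => i; rewrite tnth_mktuple ffunE.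
by apply/ffunP => i; rewrite ffunE tnth_mktuple.
Qed.

End Words.

(** The two cycles and the path between them share the path [0], [1], ...,
    [m + k + 2]; only the closing edges of the cycles are not on it. *)
Lemma dumbbell_edgeE m k i j :
  dumbbell_edge m.+1 (k%:Z - 1) 3 i j
  = [|| (j == i.+1) && (j <= (m + k).+2)%N, (i == 0%N) && (j == m)
      | (i == m + k)%N && (j == (m + k).+2)].
Proof.
have oE : absz (m.+1%:Z + (k%:Z - 1)) = (m + k)%N by lia.
rewrite /dumbbell_edge oE /cycle_edge /path_edge; lia.
Qed.

(** Distinctness of the end points of the closing edge [0], [m] is where
    [0 < m] enters. *)
Lemma proper_colouring_word (I : finType) m k
    (t : (absz (m.+1%:Z + (k%:Z - 1) + 3%:Z)).-tuple I) :
  (0 < m)%N ->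
  @proper_colouring (dumbbell m.+1 (k%:Z - 1) 3) I [ffun i => tnth t i]
  = dumbbell_word m k t.
Proof.
move=> m_gt0.
have nE : absz (m.+1%:Z + (k%:Z - 1) + 3%:Z) = (m + k).+3 by lia.
case: t => -[|a s] st; first by exfalso; move: st; rewrite nE.
have size_s : size s = (m + k).+2 by apply/eqP; rewrite -eqSS -nE.
apply/idP/idP => [/forallP proper|/and3P[/(pathP a) proper_s ma mka]].
  have colour_neq i j : (i < (m + k).+3)%N -> (j < (m + k).+3)%N -> i != j ->
      dumbbell_edge m.+1 (k%:Z - 1) 3 i j ->
      nth a (a :: s) j != nth a (a :: s) i.
    rewrite -nE => i_lt j_lt ij edge_ij.
    have /forallP/(_ (Ordinal j_lt))/implyP := proper (Ordinal i_lt).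
    rewrite !ffunE !(tnth_nth a) /= eq_sym; apply.
    by rewrite /dumbbell_adj edge_ij andbT.
  apply/and3P; split.
  - apply/(pathP a) => i; rewrite size_s => i_lt.
    apply: (colour_neq i i.+1) => //; [exact: leqW|by rewrite neq_ltn ltnSn|].
    by rewrite dumbbell_edgeE eqxx /=; lia.
  - apply: (colour_neq 0%N m) => //; [lia|lia|].
    by rewrite dumbbell_edgeE; lia.
  apply: (colour_neq (m + k)%N (m + k).+2); [lia|lia|lia|].
  by rewrite dumbbell_edgeE; lia.
have colour_neq i j : dumbbell_edge m.+1 (k%:Z - 1) 3 i j ->
    nth a (a :: s) i != nth a (a :: s) j.
  rewrite dumbbell_edgeE => /or3P[] /andP[/eqP-> ij].
  - by rewrite eq_sym; apply: proper_s; rewrite size_s.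
  - by rewrite (eqP ij) eq_sym.
  by rewrite (eqP ij) eq_sym.
apply/forallP => u; apply/forallP => v; apply/implyP => /andP[_].
rewrite !ffunE !(tnth_nth a) /= => /orP[] /colour_neq //.
by rewrite eq_sym.
Qed.

Lemma chromsym_dumbbell m k N : (0 < m)%N ->
  chromsym (dumbbell m.+1 (k%:Z - 1) 3) N = tadpole_diff (@vars N) m.+1 k *+ 2.
Proof.
move=> m_gt0; rewrite /chromsym sum_ffun_tuple -sum_dumbbell_wordsE.
under eq_bigl => t do rewrite proper_colouring_word //.
under eq_bigr => t _ do under eq_bigr => i _ do rewrite ffunE.
under eq_bigr => t _ do rewrite -(big_tuple _ _ t xpredT (@vars N)).
by have -> : absz (m.+1%:Z + (k%:Z - 1) + 3%:Z) = (m + (k + 2)).+1 by lia.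
Qed.

Theorem theorem4p3 (m : nat) (l : int) (hm : (3 <= m)%N) (hl : -1 <= l) :
  e_positive (chromsym (dumbbell m l 3)).
Proof.
case: m hm => // m m_gt1.
have [k ->] : exists k : nat, l = k%:Z - 1 by exists (absz (l + 1)); lia.
apply: eq_e_positive (e_positiveMn 2 (tadpole_diff_e_positive m k)) => N.
by rewrite chromsym_dumbbell // ltnW.
Qed.
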